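(* Let $a_k\in\mathbb{R}\setminus[-1,1]$, $k\ge1$, be distinct and let the corresponding $c_k=a_k-\sqrt{a_k^2-1}$ satisfy $$\sum_{k=1}^\infty(1-|c_k|)=\infty.$$ Then the multipoint Padé approximants $\dfrac{U_{n-1}}{T_n}$ converge, as $n\to\infty$, to $\phi(x)=\dfrac{1}{\sqrt{x^2-1}}$ locally uniformly on $\mathbb{C}\setminus[-1,1]$.
   Context: The symbol $\sqrt{x^2-1}$ denotes the branch analytic on $\mathbb{C}\setminus[-1,1]$ with $\sqrt{x^2-1}\sim x$ as $x\to\infty$ (so it is negative for real $x<-1$, and $0<|c_k|<1$). Define $f_n(z)=\prod_{k=1}^n\frac{z-c_k}{1-c_kz}$. With $x=\frac12(z+z^{-1})$, the Chebyshev rational functions are the rational functions of $x$ $$T_n(x)=\frac12\left(f_n(z)+\frac1{f_n(z)}\right),\qquad U_n(x)=\frac{1}{z-z^{-1}}\left(f_{n+1}(z)-\frac{1}{f_{n+1}(z)}\right),$$ which are well defined since both expressions are invariant under $z\mapsto 1/z$. The quotient $U_{n-1}/T_n$ is regarded as a rational function (after cancellation of common poles at the $a_k$); it is the type $[n-1/n]$ multipoint Padé approximant of $\phi$ at the points $a_1,a_1,\dots,a_n,a_n$. *)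

(* Defs.v *)
From HB Require Import structures.
From mathcomp Require Import all_boot all_order all_algebra.
From mathcomp Require Import complex ring lra.
From mathcomp Require Import all_classical all_reals all_analysis.

Set Implicit Arguments.
Unset Strict Implicit.
Unset Printing Implicit Defensive.

Import Order.TTheory GRing.Theory Num.Theory numFieldNormedType.Exports.

Local Open Scope classical_set_scope.
Local Open Scope ring_scope.
Local Open Scope complex_scope.

Notation ratfun F := {fraction {poly F}}.

(* [has_value iota r y v]: the rational function r over F, with coefficients
   mapped into L by iota, is defined at y : L and takes the value v there.
   The representation p / q ranges over all fractions equal to r, so common
   factors of numerator and denominator are cancelled.  With L = F this is
   pointwise evaluation; with L a field of rational functions it is
   substitution of y for the variable. *)
Definition has_value (F L : fieldType) (iota : {rmorphism F -> L})
    (r : ratfun F) (y v : L) : Prop :=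
  exists p q : {poly F},
    [/\ r = tofrac p / tofrac q,
        (map_poly iota q).[y] != 0 &
        v = (map_poly iota p).[y] / (map_poly iota q).[y]].

Definition ratfun_defined (F : fieldType) (r : ratfun F) (x : F) : Prop :=
  exists v : F, has_value idfun r x v.

(* 0 at the poles of r *)
Definition ratfun_eval (F : fieldType) (r : ratfun F) (x : F) : F :=
  xget 0 [set v | has_value idfun r x v].

Section HasValue.
Context (F L : fieldType) (iota : {rmorphism F -> L}).
Implicit Types (r : ratfun F) (y v : L).

Lemma has_value_uniq r y v w :
  has_value iota r y v -> has_value iota r y w -> v = w.
Proof.
move=> [p [q [-> q0 ->]]] [p' [q' [e q'0 ->]]].
have nz (t : {poly F}) : (map_poly iota t).[y] != 0 -> tofrac t != 0.
  by apply: contra_neq => /eqP; rewrite tofrac_eq0 => /eqP ->; rewrite rmorph0 horner0.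
have /eqP := e; rewrite eqr_div ?nz// -!tofracM tofrac_eq => /eqP e'.
apply/eqP; rewrite eqr_div//; apply/eqP.
by rewrite -!hornerM -!rmorphM e'.
Qed.

Lemma has_valueD r1 r2 y v1 v2 : has_value iota r1 y v1 ->
  has_value iota r2 y v2 -> has_value iota (r1 + r2) y (v1 + v2).
Proof.
move=> [p [q [-> q0 ->]]] [p' [q' [-> q'0 ->]]].
have nz (t : {poly F}) : (map_poly iota t).[y] != 0 -> tofrac t != 0.
  by apply: contra_neq => /eqP; rewrite tofrac_eq0 => /eqP ->; rewrite rmorph0 horner0.
exists (p * q' + p' * q), (q * q'); split.
- by rewrite tofracD !tofracM addf_div ?nz.
- by rewrite rmorphM hornerM mulf_neq0.
- by rewrite rmorphD !rmorphM hornerD !hornerM addf_div.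
Qed.

Lemma has_valueM r1 r2 y v1 v2 : has_value iota r1 y v1 ->
  has_value iota r2 y v2 -> has_value iota (r1 * r2) y (v1 * v2).
Proof.
move=> [p [q [-> q0 ->]]] [p' [q' [-> q'0 ->]]].
exists (p * p'), (q * q'); split.
- by rewrite !tofracM mulf_div.
- by rewrite rmorphM hornerM mulf_neq0.
- by rewrite !rmorphM !hornerM mulf_div.
Qed.

Lemma has_valueV r y v : v != 0 -> has_value iota r y v ->
  has_value iota r^-1 y v^-1.
Proof.
move=> v0 [p [q [-> q0 e]]]; exists q, p; split.
- by rewrite invf_div.
- by apply: contra_neq v0 => p0; rewrite e p0 mul0r.
- by rewrite e invf_div.
Qed.

Lemma has_valueC (a : F) y : has_value iota (tofrac a%:P) y (iota a).
Proof.
by exists a%:P, 1; rewrite tofrac1 divr1 rmorph1 map_polyC !hornerE oner_neq0 divr1.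
Qed.

Lemma has_valueX y : has_value iota (tofrac 'X) y y.
Proof.
by exists 'X, 1; rewrite tofrac1 divr1 rmorph1 map_polyX !hornerE oner_neq0 divr1.
Qed.

Lemma has_value_inj y :
  (forall p : {poly F}, (map_poly iota p).[y] = 0 -> p = 0) ->
  forall r r' v, has_value iota r y v -> has_value iota r' y v -> r = r'.
Proof.
move=> tr r r' v [p [q [-> q0 ->]]] [p' [q' [-> q'0 /eqP]]].
have nz (t : {poly F}) : (map_poly iota t).[y] != 0 -> tofrac t != 0.
  by apply: contra_neq => /eqP; rewrite tofrac_eq0 => /eqP ->; rewrite rmorph0 horner0.
rewrite eqr_div// -subr_eq0 -!hornerM -!rmorphM -hornerN -hornerD -rmorphB.
move=> /eqP /tr /eqP; rewrite subr_eq0 => /eqP e.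
by apply/eqP; rewrite eqr_div ?nz// -!tofracM e.
Qed.

End HasValue.

Lemma ratfun_evalP (F : fieldType) (r : ratfun F) (x v : F) :
  has_value idfun r x v -> ratfun_eval r x = v.
Proof.
move=> rv; rewrite /ratfun_eval.
by case: xgetP => [w _ /= rw|/(_ v)//]; exact: has_value_uniq rw rv.
Qed.

Lemma addrV_halfM (K : fieldType) (z : K) : z != 0 -> 2%:R != 0 :> K ->
  2%:R^-1 * (z ^+ 2 + 1) = (z + z^-1) / 2%:R * z.
Proof. by move=> z0 t0; field; rewrite z0 t0. Qed.

Section ChebyshevIdentities.
Context (K : fieldType) (z a f : K).
Hypotheses (z0 : z != 0) (t0 : 2%:R != 0 :> K) (w0 : z ^+ 2 - 1 != 0).
Hypotheses (x0 : z - a != 0) (y0 : 1 - a * z != 0) (f0 : f != 0).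
Let J := (z + z^-1) / 2%:R.
Let b := (z - a) / (1 - a * z).

Let b0 : b != 0. Proof. by rewrite mulf_neq0 ?invr_eq0. Qed.

Lemma cheb_den : (z - a) * (1 - a * z) / z = (1 + a ^+ 2) + (- 2%:R * a) * J.
Proof. by rewrite /J; field; rewrite z0 t0. Qed.

Lemma cheb_A : (b + b^-1) / 2%:R =
  ((1 + a ^+ 2) * J + - 2%:R * a) * ((z - a) * (1 - a * z) / z)^-1.
Proof. by rewrite /b /J; field; rewrite z0 t0 x0 y0. Qed.

Lemma cheb_B : (z - z^-1)^-1 * (b - b^-1) =
  (1 - a ^+ 2) * ((z - a) * (1 - a * z) / z)^-1.
Proof. by rewrite /b; field; rewrite z0 x0 y0 -expr2 w0. Qed.

Lemma cheb_recT : (f * b + (f * b)^-1) / 2%:R =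
  ((f + f^-1) / 2%:R) * ((b + b^-1) / 2%:R) +
  ((z - z^-1)^-1 * (f - f^-1)) * ((z - z^-1)^-1 * (b - b^-1)) * (J * J + -1).
Proof.
by move: b b0 => b' b'0; rewrite /J; field; rewrite f0 z0 t0 b'0 -expr2 w0.
Qed.

Lemma cheb_recU : (z - z^-1)^-1 * (f * b - (f * b)^-1) =
  ((f + f^-1) / 2%:R) * ((z - z^-1)^-1 * (b - b^-1)) +
  ((z - z^-1)^-1 * (f - f^-1)) * ((b + b^-1) / 2%:R).
Proof. by move: b b0 => b' b'0; field; rewrite f0 z0 t0 b'0 -expr2 w0. Qed.

End ChebyshevIdentities.

Lemma cheb_exists_gen (F L : fieldType) (iota : {rmorphism F -> L})
    (z : L) (c : nat -> F) (n : nat) :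
  let f n := \prod_(k < n) ((z - iota (c k)) / (1 - iota (c k) * z)) in
  let J := (z + z^-1) / 2%:R in
  z != 0 -> 2%:R != 0 :> L -> (forall b, z - iota b != 0) ->
  (forall b, 1 - iota b * z != 0) ->
  (exists T, has_value iota T J ((f n + (f n)^-1) / 2%:R)) /\
  (exists U, has_value iota U J ((z - z^-1)^-1 * (f n - (f n)^-1))).
Proof.
move=> f J z0 t0 x0 y0.
have hC := @has_valueC F _ iota ^~ J.
have hX := @has_valueX F _ iota J.
have wE : z ^+ 2 - 1 != 0.
  have -> : z ^+ 2 - 1 = (z - iota 1) * (z - iota (-1)).
    by rewrite rmorphN rmorph1; ring.
  by rewrite mulf_neq0.
elim: n => [|n [[T hT] [S hS]]].
  have -> : f 0%N = 1 by rewrite /f big_ord0.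
  rewrite invr1 subrr mulr0 -mulr2n (divff t0); split.
    by exists (tofrac 1%:P); have := hC 1; rewrite (rmorph1 iota).
  by exists (tofrac 0%:P); have := hC 0; rewrite (rmorph0 iota).
set a := c n; set a' := iota a.
have f0 : f n != 0.
  by apply/prodf_neq0 => k _; rewrite mulf_neq0 ?invr_eq0.
have xa : z - a' != 0 := x0 a.
have ya : 1 - a' * z != 0 := y0 a.
have h1 : has_value iota (tofrac (1 + a ^+ 2)%:P) J (1 + a' ^+ 2).
  by rewrite -(rmorphXn iota) -(rmorph1 iota) -(rmorphD iota); exact: hC.
have h2 : has_value iota (tofrac (1 - a ^+ 2)%:P) J (1 - a' ^+ 2).
  by rewrite -(rmorphXn iota) -(rmorph1 iota) -(rmorphB iota); exact: hC.
have h3 : has_value iota (tofrac (- 2%:R * a)%:P) J (- 2%:R * a').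
  by rewrite -(rmorph_nat iota) -(rmorphN iota) -(rmorphM iota); exact: hC.
have h4 : has_value iota (tofrac (-1)%:P) J (-1).
  by rewrite -(rmorph1 iota) -(rmorphN iota); exact: hC.
have d0 : (z - a') * (1 - a' * z) / z != 0.
  by rewrite !mulf_neq0 ?invr_eq0.
have dV := has_valueD h1 (has_valueM h3 hX).
rewrite -(cheb_den _ z0 t0) in dV.
have {}dV := has_valueV d0 dV.
have hA := has_valueM (has_valueD (has_valueM h1 hX) h3) dV.
rewrite -(cheb_A z0 t0 xa ya) in hA.
have hB := has_valueM h2 dV.
rewrite -(cheb_B z0 wE xa ya) in hB.
have -> : f n.+1 = f n * ((z - a') / (1 - a' * z)) by rewrite /f big_ord_recr.
rewrite (cheb_recT z0 t0 wE xa ya f0) (cheb_recU z0 t0 wE xa ya f0).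
split; eexists.
  exact: has_valueD (has_valueM hT hA) (has_valueM (has_valueM hS hB)
    (has_valueD (has_valueM hX hX) h4)).
exact: has_valueD (has_valueM hT hB) (has_valueM hS hA).
Qed.

Section Chebyshev.
Context (F : numFieldType).
Implicit Types (c : nat -> F) (n k : nat).

Definition ratfunC : {rmorphism F -> ratfun F} := (@tofrac {poly F} \o polyC)%FUN.
Definition zvar : ratfun F := tofrac 'X.
Definition joukowski : ratfun F := (zvar + zvar^-1) / 2%:R.

(* c 0, c 1, ... are c_1, c_2, ... *)
Definition cheb_f c n : ratfun F :=
  \prod_(k < n) ((zvar - ratfunC (c k)) / (1 - ratfunC (c k) * zvar)).

Definition is_chebT c n (T : ratfun F) : Prop :=
  has_value ratfunC T joukowski ((cheb_f c n + (cheb_f c n)^-1) / 2%:R).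

Definition is_chebU c n (U : ratfun F) : Prop :=
  has_value ratfunC U joukowski
    ((zvar - zvar^-1)^-1 * (cheb_f c n.+1 - (cheb_f c n.+1)^-1)).

Definition chebT c n : ratfun F := xget 0 [set T | is_chebT c n T].
Definition chebU c n : ratfun F := xget 0 [set U | is_chebU c n U].

Lemma zvar_neq0 : zvar != 0.
Proof. by rewrite /zvar tofrac_eq0 polyX_eq0. Qed.

Lemma zvarBC_neq0 (a : F) : zvar - ratfunC a != 0.
Proof. by rewrite /zvar /ratfunC/= -tofracB tofrac_eq0 polyXsubC_eq0. Qed.

Lemma one_subCz_neq0 (a : F) : 1 - ratfunC a * zvar != 0.
Proof.
rewrite /zvar /ratfunC/= -tofrac1 -tofracM -tofracB tofrac_eq0.
apply/eqP => /(congr1 (fun p : {poly F} => p.[0])) /eqP.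
by rewrite !hornerE subr0 oner_eq0.
Qed.

Lemma two_ratfun_neq0 : (2%:R : ratfun F) != 0.
Proof.
rewrite -(rmorph_nat ratfunC) /ratfunC/= tofrac_eq0 polyC_eq0.
by rewrite pnatr_eq0.
Qed.

Lemma cheb_exists c n : (exists T, is_chebT c n T) /\
  (exists S, has_value ratfunC S joukowski
    ((zvar - zvar^-1)^-1 * (cheb_f c n - (cheb_f c n)^-1))).
Proof.
exact: (cheb_exists_gen c n zvar_neq0 two_ratfun_neq0 zvarBC_neq0 one_subCz_neq0).
Qed.

Lemma joukowski_transcendental (p : {poly F}) :
  (map_poly ratfunC p).[joukowski] = 0 -> p = 0.
Proof.
move=> p0; apply/eqP; apply: contraTT isT => pn0.
have : (\sum_(i < size p) (p`_i)%:P * ((2%:R^-1)%:P * ('X^2 + 1)) ^+ i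
          * 'X^((size p).-1 - i)).[0] = 0 :> F.
  suff -> : \sum_(i < size p) (p`_i)%:P * ((2%:R^-1)%:P * ('X^2 + 1)) ^+ i
          * 'X^((size p).-1 - i) = 0 by rewrite horner0.
  apply/eqP; rewrite -tofrac_eq0; apply/eqP.
  transitivity (zvar ^+ (size p).-1 * (map_poly ratfunC p).[joukowski]).
    rewrite (big_morph _ (@tofracD _) (@tofrac0 _)) horner_poly mulr_sumr.
    apply: eq_bigr => i _.
    have ip : (i <= (size p).-1)%N by rewrite -ltnS prednK ?size_poly_gt0.
    rewrite !tofracM !tofracXn -/zvar tofracM tofracD tofracXn tofrac1 -/zvar.
    have -> : tofrac (2%:R^-1)%:P = 2%:R^-1 :> ratfun F.
      by rewrite -[LHS]/(ratfunC _) fmorphV rmorph_nat.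
    have -> : 2%:R^-1 * (zvar ^+ 2 + 1) = joukowski * zvar.
      exact: addrV_halfM zvar_neq0 two_ratfun_neq0.
    rewrite exprMn -[in RHS](subnKC ip) exprD.
    set u := zvar ^+ _; set v := zvar ^+ _; set w := joukowski ^+ _.
    by rewrite /ratfunC/=; ring.
  by rewrite p0 mulr0.
case: (size p) (size_poly_gt0 p) (lead_coefE p) => [|m] ; rewrite pn0// => _ lp.
rewrite big_ord_recr/= hornerD horner_sum big1 ?add0r => [|i _].
  rewrite subnn expr0 mulr1 hornerM horner_exp hornerC.
  have -> : ((2%:R^-1)%:P * ('X^2 + 1)).[0] = 2%:R^-1 :> F.
    by rewrite !hornerE expr0n/= add0r mulr1.
  move/eqP; rewrite mulf_eq0 expf_eq0 invr_eq0 pnatr_eq0 andbF orbF.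
  by move: lp; rewrite /= => <-; rewrite lead_coef_eq0 (negbTE pn0).
by rewrite hornerM hornerXn expr0n subn_eq0 leqNgt ltn_ord/= mulr0.
Qed.

Lemma has_value_joukowski_inj (r r' v : ratfun F) :
  has_value ratfunC r joukowski v -> has_value ratfunC r' joukowski v -> r = r'.
Proof.
exact: (@has_value_inj F (ratfun F) ratfunC joukowski joukowski_transcendental).
Qed.

Lemma chebTP c n : is_chebT c n (chebT c n).
Proof.
have [[T hT] _] := cheb_exists c n.
by rewrite /chebT; case: xgetP => [//|/(_ T)].
Qed.

Lemma chebUP c n : is_chebU c n (chebU c n).
Proof.
have [_ [U hU]] := cheb_exists c n.+1.
by rewrite /chebU; case: xgetP => [//|/(_ U)].
Qed.

End Chebyshev.

(* Local uniform convergence on D of rational functions: near every point of D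
   the r n are eventually free of poles and converge uniformly. *)
Definition ratfun_cvg_locally_uniformly (K : numFieldType)
    (r : nat -> ratfun K) (phi : K -> K) (D : set K) : Prop :=
  forall x, D x -> exists2 V, nbhs x V &
    (\forall n \near \oo, forall y, (V `&` D) y -> ratfun_defined (r n) y) /\
    {uniform V `&` D, (fun n => ratfun_eval (r n)) @ \oo --> phi}.

Section SqrtBranch.
Context (R : realType).

Definition off_segment : set R[i] := ~` [set t%:C | t in `[-1, 1]].

(* Complex differentiability at every point of the open set off_segment is
   analyticity there; R[i]^o is R[i] as a normed module over itself. *)
Definition is_sqrt_x2m1 (s : R[i] -> R[i]) : Prop :=
  [/\ forall x, off_segment x -> s x ^+ 2 = x ^+ 2 - 1,
      forall x, off_segment x -> derivable (s : R[i]^o -> R[i]^o) x 1 &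
      forall e : R, 0 < e -> exists M : R, forall x : R[i],
        M%:C < `|x| -> `|s x / x - 1| < e%:C].

End SqrtBranch.

Arguments off_segment R : clear implicits.

Section SqrtContinuity.
Context (K : numFieldType).

Lemma sqrt_lipschitz (sq : K -> K) (rho w w0 : K) : 0 < rho ->
  (forall u, sq u ^+ 2 = u) -> rho <= `|sq w + sq w0| ->
  `|sq w - sq w0| <= rho^-1 * `|w - w0|.
Proof.
move=> rho0 sqE h; rewrite -[in X in _ <= _ * X](sqE w) -[in X in _ <= _ * X](sqE w0).
rewrite subr_sqr normrM mulrCA ler_peMr// mulrC ler_pdivlMr// mul1r.
exact: h.
Qed.

Lemma sqrt_continuous (sq : K -> K) (rho w0 : K) : 0 < rho ->
  (forall u, sq u ^+ 2 = u) -> (forall w, rho <= `|sq w + sq w0|) ->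
  {for w0, continuous sq}.
Proof.
move=> rho0 sqE h; apply/(@cvgrPdist_lt _ _ _ (nbhs w0)) => e e0.
near=> w; rewrite distrC.
apply: le_lt_trans (sqrt_lipschitz rho0 sqE (h w)) _.
rewrite mulrC ltr_pdivrMr//.
by near: w; apply: cvgr_distC_lt => //; rewrite mulr_gt0.
Unshelve. all: by end_near. Qed.

Lemma sqrt_x2m1_continuous (sq : K -> K) (rho x0 : K) : 0 < rho -> x0 != 0 ->
  (forall u, sq u ^+ 2 = u) ->
  (forall w, rho <= `|sq w + sq (1 - (x0 * x0)^-1)|) ->
  {for x0, continuous (fun x : K => x * sq (1 - (x * x)^-1))}.
Proof.
move=> rho0 x00 sqE h; have c := sqrt_continuous rho0 sqE h.
have cid : {for x0, continuous (fun x : K => x)} by exact: cvg_id.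
have c1 : {for x0, continuous (fun x : K => (x * x)^-1)}.
  by apply: (@continuousV K K); [rewrite mulf_neq0|exact: (@continuousM K K)].
have c2 : {for x0, continuous (fun x : K => 1 - (x * x)^-1)}.
  apply: (@continuousB K K^o K (fun=> 1)) => //. exact: (@cst_continuous K K).
apply: (@continuousM K K (fun x => x)) => //.
exact: (continuous_comp c2 c).
Qed.

Lemma sqrt_x2m1_derivable (s : K -> K) (x0 : K) : s x0 != 0 ->
  {for x0, continuous s} -> (\forall x \near x0, s x ^+ 2 = x ^+ 2 - 1) ->
  derivable (s : K^o -> K^o) x0 1.
Proof.
move=> s0 sc sE; apply/cvg_ex; exists ((x0 + x0) / (s x0 + s x0)).
have ss0 : s x0 + s x0 != 0 by rewrite -mulr2n mulrn_eq0.
have cid : {for 0, continuous (fun h : K => h)} by exact: cvg_id.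
pose g (h : K) := h * 1 + x0.
have g0 : g 0 = x0 by rewrite /g mul0r add0r.
have cg : {for 0, continuous g}.
  apply: (@continuousD K K^o K (fun h => h * 1)) => [|]; last exact: (@cst_continuous K K).
  by apply: (@continuousM K K (fun x => x)) => //; exact: (@cst_continuous K K).
have csg : {for 0, continuous (fun h => s (g h))}.
  by apply: (continuous_comp cg); rewrite g0.
have cq : {for 0, continuous (fun h => (g h + x0) / (s (g h) + s x0))}.
  apply: (@continuousM K K (fun h => g h + x0)).
    by apply: (@continuousD K K^o K g) => //; exact: (@cst_continuous K K).
  apply: (@continuousV K K); first by rewrite g0.
  by apply: (@continuousD K K^o K (fun h => s (g h))) => //; exact: (@cst_continuous K K).
have nzn : \forall h \near (0 : K), s (g h) + s x0 != 0.
  have cs : {for 0, continuous (fun h => s (g h) + s x0)}.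
    by apply: (@continuousD K K^o K (fun h => s (g h))) => //; exact: (@cst_continuous K K).
  by apply: (cvgr_neq0 (s (g 0) + s x0) cs); rewrite g0.
have sEn : \forall h \near (0 : K), s (g h) ^+ 2 = g h ^+ 2 - 1.
  by apply: (cg (fun y => s y ^+ 2 = y ^+ 2 - 1)); rewrite [nbhs _]/(nbhs (g 0)) g0.
have sE0 : s x0 ^+ 2 = x0 ^+ 2 - 1 := nbhs_singleton sE.
have cq' : (g h + x0) / (s (g h) + s x0) @[h --> 0^'] -->
    (x0 + x0) / (s x0 + s x0).
  have -> : (x0 + x0) / (s x0 + s x0) = (g 0 + x0) / (s (g 0) + s x0) by rewrite g0.
  exact: (@cvg_within_filter _ _ _ (nbhs (0 : K)) _ _ (fun y => y != 0) cq).
apply: cvg_trans cq'; apply: near_eq_cvg.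
near=> h.
have h0 : h != 0 by near: h; exact: nbhs_dnbhs_neq.
have sEh : s (g h) ^+ 2 = g h ^+ 2 - 1.
  by near: h; exact: (nbhs_dnbhs sEn).
have nz : s (g h) + s x0 != 0.
  by near: h; exact: (nbhs_dnbhs nzn).
rewrite -[RHS]/(h^-1 * (s (g h) - s x0)).
apply: (mulfI h0); rewrite [RHS]mulrA divff// mul1r.
apply: (mulIf nz); rewrite -mulrA divfK//.
rewrite -subr_sqr sEh sE0 /g; ring.
Unshelve. all: by end_near. Qed.

Lemma near_neq0 (x : K) : x != 0 -> \forall y \near x, y != 0.
Proof.
have cx : {for x, continuous (fun y : K => y)} by exact: cvg_id.
exact: (cvgr_neq0 x cx).
Qed.

End SqrtContinuity.

Section SqrtBranchExists.
Context (R : realType).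

Lemma Re_sqrtc_ge0 (w : R[i]) : 0 <= complex.Re (sqrtc w).
Proof. by case: w => u v /=; exact: sqrtr_ge0. Qed.

Lemma Re_sqrtc_gt0 (w : R[i]) :
  (forall t : R, w != (- t ^+ 2)%:C) -> 0 < complex.Re (sqrtc w).
Proof.
move=> h; rewrite lt_neqAle Re_sqrtc_ge0 andbT eq_sym; apply/eqP => e.
have := sqr_sqrtc w; have := h (complex.Im (sqrtc w)).
case: (sqrtc w) e => u v /= -> /eqP h' e; apply: h'.
rewrite -e expr2; apply/eqP; rewrite eq_complex /=.
by rewrite !mul0r mulr0 addr0 sub0r expr2 !eqxx.
Qed.

Lemma normcD_sqrtc (w w0 : R[i]) :
  (complex.Re (sqrtc w0))%:C <= `|sqrtc w + sqrtc w0|.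
Proof.
apply: le_trans (normc_ge_Re _); rewrite lecR.
rewrite raddfD /= ger0_norm ?addr_ge0 ?Re_sqrtc_ge0//.
by rewrite lerDr Re_sqrtc_ge0.
Qed.

Lemma is_sqrt_x2m1_exists : exists s : R[i] -> R[i], is_sqrt_x2m1 s.
Proof.
pose s (x : R[i]) := x * sqrtc (1 - (x * x)^-1).
have sE x : x != 0 -> s x ^+ 2 = x ^+ 2 - 1.
  by move=> x0; rewrite /s exprMn sqr_sqrtc -expr2 mulrBr mulr1 divff ?expf_neq0.
have D0 x : off_segment R x -> x != 0.
  move=> Dx; apply/eqP => x0; apply: Dx; exists 0 => //=.
  by rewrite in_itv/= lerN10 ler01.
exists s; split.
- by move=> x /D0; exact: sE.
- move=> x Dx; have x0 := D0 _ Dx.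
  have Rgt0 : 0 < complex.Re (sqrtc (1 - (x * x)^-1)).
    apply: Re_sqrtc_gt0 => t; apply/eqP => e; apply: Dx.
    have t1 : 0 < 1 + t ^+ 2 by rewrite ltr_pwDl// sqr_ge0.
    have xx : x ^+ 2 = ((Num.sqrt (1 + t ^+ 2))^-1)%:C ^+ 2.
      have xV : (x * x)^-1 = (1 + t ^+ 2)%:C.
        transitivity (1 - (- t ^+ 2)%:C); first by rewrite -e opprB addrC subrK.
        apply/eqP; rewrite eq_complex; apply/andP; split; apply/eqP => /=; ring.
      have -> : ((Num.sqrt (1 + t ^+ 2))^-1)%:C ^+ 2 = ((1 + t ^+ 2)^-1)%:C.
        by rewrite -[LHS]rmorphXn/= exprVn sqr_sqrtr// ltW.
      have -> : ((1 + t ^+ 2)^-1)%:C = (1 + t ^+ 2)%:C^-1 by exact: (fmorphV (real_complex R)).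
      by rewrite -xV invrK expr2.
    have u1 : (Num.sqrt (1 + t ^+ 2))^-1 <= 1 :> R.
      rewrite invf_le1 ?sqrtr_gt0// -[leLHS]sqrtr1 ler_wsqrtr// lerDl.
      exact: sqr_ge0.
    have u0 : 0 <= (Num.sqrt (1 + t ^+ 2))^-1 by rewrite invr_ge0 sqrtr_ge0.
    have /eqP := xx; rewrite eqf_sqr => /orP[] /eqP ->.
      exists (Num.sqrt (1 + t ^+ 2))^-1 => //=.
      by rewrite in_itv/= u1 (le_trans _ u0)// lerN10.
    exists (- (Num.sqrt (1 + t ^+ 2))^-1); last by rewrite rmorphN.
    by rewrite /= in_itv/= lerN2 u1/= (le_trans _ (@ler01 R))// oppr_le0.
  have sx0 : s x != 0.
    rewrite mulf_neq0//; apply: contraTneq Rgt0 => ->.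
    by rewrite ltxx.
  apply: (@sqrt_x2m1_derivable R[i] s x) => //.
    apply: (@sqrt_x2m1_continuous R[i] (@sqrtc R)
      (complex.Re (sqrtc (1 - (x * x)^-1)))%:C) => //.
    - by rewrite ltcR.
    - exact: sqr_sqrtc.
    - by move=> w; exact: normcD_sqrtc.
  by apply: filterS (@near_neq0 R[i] x x0) => y; exact: sE.
- move=> e e0; exists (1 + e^-1) => x hx.
  have x1 : 1 < `|x|.
    by apply: le_lt_trans hx; rewrite -[1]/(1%:C) lecR lerDl invr_ge0 ltW.
  have x0 : x != 0 by rewrite -normr_gt0 (lt_trans _ x1).
  rewrite /s mulrAC divff// mul1r.
  have -> : sqrtc (1 - (x * x)^-1) - 1 = sqrtc (1 - (x * x)^-1) - sqrtc 1.
    by rewrite [in RHS]sqrtc1.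
  have h1 : 1 <= `|sqrtc (1 - (x * x)^-1) + sqrtc 1|.
    by have := normcD_sqrtc (1 - (x * x)^-1) 1; rewrite {1}sqrtc1.
  have h2 := @sqrt_lipschitz R[i] (@sqrtc R) 1 (1 - (x * x)^-1) 1 ltr01
     (@sqr_sqrtc R) h1.
  apply: (le_lt_trans h2).
  rewrite invr1 mul1r addrAC subrr add0r normrN normfV normrM invfM.
  have e1 : `|x|^-1 < e%:C.
    have xp : 0 < `|x| := lt_trans ltr01 x1.
    have ep : 0 < e%:C by rewrite ltcR.
    rewrite invf_plt//.
    have -> : (e%:C)^-1 = (e^-1)%:C by rewrite (fmorphV (real_complex R)).
    apply: (le_lt_trans _ hx).
    by rewrite lecR lerDr ler01.
  apply: le_lt_trans e1; rewrite ler_piMr ?invr_ge0//.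
  by rewrite invf_le1 ?ltW//; exact: lt_trans x1.
Qed.

End SqrtBranchExists.

(* Main.v *)
Require Import Defs.
From mathcomp Require Import all_boot all_order all_algebra.
From mathcomp Require Import complex ring lra.
From mathcomp Require Import all_classical all_reals all_analysis.

(** Put z = x - sqrt(x^2-1), so that x = (z + 1/z) / 2, sqrt(x^2-1) = (1/z - z) / 2
and the quotient of U_(n-1) by T_n takes at x the value
   (1 / sqrt(x^2-1)) * (1 - f^2) / (1 + f^2),   where f = f_n(z).
So it suffices that f_n tends to 0 uniformly near each point off the segment. This
rests on two estimates and on a rewriting of the quotient.

The map x |-> z sends the complement of [-1,1] into the open unit disc
([inverse_normc_lt1]). It never has modulus 1 there, since a z of modulus 1 gives
x = Re z in [-1,1]; it is small far away, since sqrt(x^2-1) ~ x; and a point x is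
joined to infinity by the ray of its multiples t x, t >= 1, which avoids the
segment, so the intermediate value theorem applies along the ray. In particular
the c_k, which are real, satisfy |c_k| < 1.

Each factor of f_n is a disc automorphism, and when |z| <= rho < 1 the square of its
modulus is at most 1 - (1 - rho^2)/4 * (1 - |c_k|) ([moebius_factor_bound]). By the
elementary bound prod (1 - u_k) <= 1 / (1 + sum u_k) of [prod_1B_le], the divergence
of sum (1 - |c_k|) forces |f_n|^2 to 0 uniformly over |z| <= rho.

The quotient has no poles off the segment, although T_n and U_(n-1) separately
have poles at the a_k. So the quotient is written as P_n / Q_n with polynomials for
which the common denominator has been cancelled ([cheb_quotient]). Up to a power of z,
Q_n(x) is half of prod (z - c_k)^2 + prod (1 - c_k z)^2 ([cheb_num_value]), whose second
term dominates as soon as |f_n|^2 <= 1/2. *)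

Set Implicit Arguments.
Unset Strict Implicit.
Unset Printing Implicit Defensive.

Import Order.TTheory GRing.Theory Num.Theory numFieldNormedType.Exports.

Local Open Scope classical_set_scope.
Local Open Scope ring_scope.
Local Open Scope complex_scope.

(** * Polynomial numerators and denominator of the Chebyshev functions *)

Section ChebyshevPolynomials.
Context {F : fieldType} (c : nat -> F).

(** The pair holds the numerators of T_n and of U_(n-1) over the common denominator
[cheb_den]. The recursion is the addition theorem for cosh and sinh, f being the
exponential: multiplying f by one more factor b replaces cosh by
cosh * (b + 1/b)/2 + sinh * (b - 1/b)/2. With b = (z - a)/(1 - a z), the polynomials u
and v are (b + 1/b)/2 and (b - 1/b)/(z - 1/z) multiplied by their common denominator
1 + a^2 - 2 a x, and x^2 - 1 is the square of (z - 1/z)/2. *)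
Fixpoint cheb_num (n : nat) : {poly F} * {poly F} :=
  if n is m.+1 then
    let: (p, q) := cheb_num m in
    let u := (1 + c m ^+ 2)%:P * 'X - (2%:R * c m)%:P in
    let v := (1 - c m ^+ 2)%:P in
    (p * u + q * v * ('X ^+ 2 - 1), p * v + q * u)
  else (1, 0).

Definition cheb_den (n : nat) : {poly F} :=
  \prod_(k < n) ((1 + c k ^+ 2)%:P - (2%:R * c k)%:P * 'X).

End ChebyshevPolynomials.

Section ChebyshevValues.
Context {F L : fieldType} (iota : {rmorphism F -> L}) (c : nat -> F) (z : L).
Hypotheses (z0 : z != 0) (two0 : 2%:R != 0 :> L) (z1 : z ^+ 2 != 1).

Let J := (z + z^-1) / 2%:R.
Let X n : L := \prod_(k < n) (z - iota (c k)).
Let Y n : L := \prod_(k < n) (1 - iota (c k) * z).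

(** The field L is arbitrary so that z can be either the variable of a field of
rational functions, which identifies the Chebyshev functions, or a number, which
gives their values. *)
Lemma cheb_num_value n :
  (map_poly iota (cheb_num c n).1).[J] =
    z^-1 ^+ n * (X n ^+ 2 + Y n ^+ 2) / 2%:R /\
  (map_poly iota (cheb_num c n).2).[J] =
    z^-1 ^+ n * (X n ^+ 2 - Y n ^+ 2) / (z - z^-1).
Proof.
have w0 : z * z - 1 != 0 by rewrite subr_eq0 -expr2.
elim: n => [|n].
  rewrite /= rmorph1 rmorph0 hornerC horner0 /X /Y !big_ord0 expr0 expr1n subrr.
  by rewrite mul1r mulr0 mul0r -mulr2n divff.
rewrite /=; case: (cheb_num c n) => p q /= [hp hq].
rewrite !(rmorphD, rmorphN, rmorphM, rmorphXn, rmorph1) /=.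
rewrite !hornerE /= hp hq.
rewrite !(map_polyC, map_polyX) /= !hornerE.
rewrite /X /Y !big_ord_recr /= -/(X n) -/(Y n).
move: (X n) (Y n) (iota (c n)) => x y a.
rewrite [z^-1 ^+ _.+1]exprSr; move: (z^-1 ^+ n) => zn {hp hq}.
by split; rewrite /J; field; rewrite ?z0 ?two0 ?w0.
Qed.

Lemma cheb_den_value n :
  (map_poly iota (cheb_den c n)).[J] = z^-1 ^+ n * (X n * Y n).
Proof.
rewrite /cheb_den /X /Y rmorph_prod horner_prod -big_split /=.
rewrite -[in z^-1 ^+ n](card_ord n) -prodr_const -big_split /=.
apply: eq_bigr => k _.
rewrite !(rmorphD, rmorphN, rmorphM, rmorphXn, rmorph1) /=.
rewrite !hornerE /=.
rewrite !(map_polyC, map_polyX) /= !hornerE.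
by rewrite /J /=; field; rewrite z0 two0.
Qed.

Let f n : L := \prod_(k < n) ((z - iota (c k)) / (1 - iota (c k) * z)).

Lemma has_value_cheb n :
  (forall k, z - iota (c k) != 0) -> (forall k, 1 - iota (c k) * z != 0) ->
  [/\ cheb_den c n != 0,
      has_value iota (tofrac (cheb_num c n).1 / tofrac (cheb_den c n)) J
        ((f n + (f n)^-1) / 2%:R) &
      has_value iota (tofrac (cheb_num c n).2 / tofrac (cheb_den c n)) J
        ((z - z^-1)^-1 * (f n - (f n)^-1))].
Proof.
move=> x0 y0.
have w0 : z * z - 1 != 0 by rewrite subr_eq0 -expr2.
have X0 : X n != 0 by apply/prodf_neq0 => k _.
have Y0 : Y n != 0 by apply/prodf_neq0 => k _.
have fE : f n = X n / Y n by rewrite /f /X /Y -prodfV -big_split.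
have u0 : z^-1 ^+ n != 0 by rewrite expf_neq0 // invr_eq0.
have [vT vU] := cheb_num_value n; have vD := cheb_den_value n.
have D0 : (map_poly iota (cheb_den c n)).[J] != 0.
  by rewrite vD !mulf_neq0.
split; [|eexists; exists (cheb_den c n); split=> //..].
- by apply: contra_neq D0 => ->; rewrite rmorph0 horner0.
- rewrite vT vD fE; move: (X n) (Y n) (z^-1 ^+ n) X0 Y0 u0 => x y u X0 Y0 u0.
  by field; rewrite X0 Y0 two0 u0.
- rewrite vU vD fE; move: (X n) (Y n) (z^-1 ^+ n) X0 Y0 u0 => x y u X0 Y0 u0.
  by field; rewrite X0 Y0 w0 u0 z0.
Qed.

End ChebyshevValues.

(** The right-hand side has no denominator vanishing at the a_k, so it can be
evaluated at the poles of T_n and U_(n-1) as well. *)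
Lemma cheb_quotient {F : numFieldType} (c : nat -> F) n :
  chebU c n / chebT c n.+1 =
  tofrac (cheb_num c n.+1).2 / tofrac (cheb_num c n.+1).1.
Proof.
have z1 : zvar F ^+ 2 != 1.
  rewrite -subr_eq0 (_ : _ - 1 = (zvar F - ratfunC F 1) * (zvar F - ratfunC F (-1))).
    exact: mulf_neq0 (zvarBC_neq0 _) (zvarBC_neq0 _).
  by rewrite rmorphN rmorph1; ring.
have [d0 vT vU] := @has_value_cheb F _ (ratfunC F) c _ (zvar_neq0 F)
  (two_ratfun_neq0 F) z1 n.+1 (fun k => zvarBC_neq0 (c k))
  (fun k => one_subCz_neq0 (c k)).
have -> := has_value_joukowski_inj (chebTP c n.+1) vT.
have -> := has_value_joukowski_inj (chebUP c n) vU.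
have {}d0 : tofrac (cheb_den c n.+1) != 0 by rewrite tofrac_eq0.
by rewrite invf_div mulrA (divfK d0).
Qed.

Lemma cheb_quotient_value {F : numFieldType} (c : nat -> F) (z : F) n :
  let X := \prod_(k < n) (z - c k) in
  let Y := \prod_(k < n) (1 - c k * z) in
  z != 0 -> z ^+ 2 != 1 -> X ^+ 2 + Y ^+ 2 != 0 ->
  has_value idfun (tofrac (cheb_num c n).2 / tofrac (cheb_num c n).1)
    ((z + z^-1) / 2%:R)
    (2%:R / (z - z^-1) * ((X ^+ 2 - Y ^+ 2) / (X ^+ 2 + Y ^+ 2))).
Proof.
move=> X Y z0 z1 S0.
have two0 : 2%:R != 0 :> F by rewrite pnatr_eq0.
have [/= vT vU] := @cheb_num_value F F idfun c z z0 two0 z1 n.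
have u0 : z^-1 ^+ n != 0 by rewrite expf_neq0 // invr_eq0.
have w0 : z * z - 1 != 0 by rewrite subr_eq0 -expr2.
rewrite -/X -/Y in vT vU.
eexists; exists (cheb_num c n).1; split=> //.
  by rewrite vT !mulf_neq0 // invr_eq0.
rewrite vT vU; move: X Y (z^-1 ^+ n) S0 u0 {vT vU} => x y u S0 u0.
by field; rewrite S0 w0 u0 z0.
Qed.

(** * Estimates *)

(** The error of the approximant, where w is the limit and x / y is f_n: the difference
equals 2 w x^2 / (x^2 + y^2), and |x^2 + y^2| >= |y|^2 / 2. *)
Lemma sum_sqr_quotient_bound {K : numFieldType} (x y w q : K) :
  y != 0 -> 0 <= q -> q <= 2%:R^-1 -> `|x| ^+ 2 <= q * `|y| ^+ 2 ->
  x ^+ 2 + y ^+ 2 != 0 /\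
  `|w - - w * ((x ^+ 2 - y ^+ 2) / (x ^+ 2 + y ^+ 2))| <= 4%:R * q * `|w|.
Proof.
move=> y0 q0 q2 xy.
have yp : 0 < `|y| ^+ 2 by rewrite exprn_gt0 // normr_gt0.
have S : 2%:R^-1 * `|y| ^+ 2 <= `|x ^+ 2 + y ^+ 2|.
  rewrite addrC; apply: le_trans (lerB_normD _ _).
  rewrite !normrX lerBrDr -lerBrDl (le_trans xy) //.
  have -> : `|y| ^+ 2 - 2%:R^-1 * `|y| ^+ 2 = 2%:R^-1 * `|y| ^+ 2.
    by field.
  by rewrite ler_wpM2r // ltW.
have Sp : 0 < `|x ^+ 2 + y ^+ 2|.
  by apply: lt_le_trans S; rewrite mulr_gt0 // invr_gt0 ltr0n.
have S0 : x ^+ 2 + y ^+ 2 != 0 by rewrite -normr_gt0.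
split=> //.
have -> : w - - w * ((x ^+ 2 - y ^+ 2) / (x ^+ 2 + y ^+ 2)) =
    w * (2%:R * x ^+ 2 / (x ^+ 2 + y ^+ 2)) by field.
rewrite normrM mulrC ler_wpM2r // normf_div normrM normr_nat normrX.
rewrite ler_pdivrMr //.
have : 4%:R * q * (2%:R^-1 * `|y| ^+ 2) <= 4%:R * q * `|x ^+ 2 + y ^+ 2|.
  by rewrite ler_wpM2l // mulr_ge0 // ler0n.
apply: le_trans.
have -> : 4%:R * q * (2%:R^-1 * `|y| ^+ 2) = 2%:R * (q * `|y| ^+ 2) by field.
by rewrite ler_wpM2l // ler0n.
Qed.

(** Each factor satisfies 1 - u <= 1 / (1 + u), and the product of the 1 + u_k is at
least 1 + sum u_k. *)
Lemma prod_1B_le {R : realFieldType} (u : nat -> R) n :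
  (forall k, 0 <= u k <= 1) ->
  0 <= \prod_(k < n) (1 - u k) <= (1 + \sum_(k < n) u k)^-1.
Proof.
move=> u01.
have S0 m : 0 <= \sum_(k < m) u k.
  by apply: sumr_ge0 => k _; have /andP[] := u01 k.
apply/andP; split.
  by apply: prodr_ge0 => k _; rewrite subr_ge0; have /andP[] := u01 k.
elim: n => [|n IH]; first by rewrite !big_ord0 addr0 invr1.
rewrite !big_ord_recr /=.
have /andP[un0 un1] := u01 n; have Sn := S0 n.
move: (\sum_(k < n) u k) (\prod_(k < n) (1 - u k)) (u n) un0 un1 Sn IH.
move=> s p v v0 v1 s0 ps.
have s1 : 0 < 1 + s by lra.
have sv : 0 < 1 + (s + v) by lra.
apply: (@le_trans _ _ ((1 + s)^-1 * (1 - v))); first by rewrite ler_wpM2r // subr_ge0.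
rewrite -[leRHS]mul1r ler_pdivlMr // mulrAC -mulrA ler_pdivrMl // mulr1.
nra.
Qed.

(** The identity |1 - c z|^2 - |z - c|^2 = (1 - c^2) (1 - |z|^2), valid for real c, gives
the gap, because |1 - c z|^2 <= 4 and 1 - c^2 >= 1 - |c|. *)
Lemma moebius_factor_bound {R : rcfType} (z : R[i]) (c rho : R) :
  `|c| < 1 -> 0 <= rho -> rho < 1 -> `|z| <= rho%:C ->
  `|z - c%:C| ^+ 2 <=
  (1 - (1 - rho ^+ 2) / 4%:R * (1 - `|c|))%:C * `|1 - c%:C * z| ^+ 2.
Proof.
move=> c1 r0 r1 zr.
have : `|z| ^+ 2 <= rho%:C ^+ 2 by rewrite ler_pXn2r // nnegrE // lecR.
rewrite -[rho%:C ^+ 2]rmorphXn -!add_Re2_Im2 -rmorphM !lecR.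
case: z {zr} => x y /= h.
rewrite !(mul0r, mulr0, subr0, addr0, add0r, sub0r, oppr0).
have r2 : rho ^+ 2 <= 1 by rewrite expr_le1 // ltW.
have cc : c ^+ 2 <= `|c| by rewrite -real_normK ?num_real // expr2 ler_piMl // ltW.
have c2 : c ^+ 2 <= 1 by apply: le_trans cc (ltW c1).
have c20 := sqr_ge0 c; have x20 := sqr_ge0 x; have y20 := sqr_ge0 y.
set N := (1 - c * x) ^+ 2 + (- (c * y)) ^+ 2.
have N4 : N <= 4%:R.
  have : 0 <= (c + x) ^+ 2 by exact: sqr_ge0.
  have : c ^+ 2 * (x ^+ 2 + y ^+ 2) <= 1 by apply: mulr_ile1; lra.
  by rewrite /N; nra.
have NE : N - ((x - c) ^+ 2 + y ^+ 2) = (1 - c ^+ 2) * (1 - (x ^+ 2 + y ^+ 2)).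
  by rewrite /N; ring.
have m1 : (1 - rho ^+ 2) * (1 - `|c|) * N <= (1 - rho ^+ 2) * (1 - `|c|) * 4%:R.
  by rewrite ler_wpM2l // mulr_ge0 // subr_ge0 // ltW.
have m2 : (1 - rho ^+ 2) * (1 - `|c|) <= (1 - (x ^+ 2 + y ^+ 2)) * (1 - c ^+ 2).
  by apply: ler_pM; lra.
lra.
Qed.

(** * The inverse Joukowski map off the segment *)

Lemma normcR {R : rcfType} (r : R) : `|r%:C| = `|r|%:C.
Proof. by rewrite normc_def /= expr0n addr0 sqrtr_sqr. Qed.

Lemma normcRe {R : rcfType} (w : R[i]) : `|w| = (complex.Re `|w|)%:C.
Proof. by rewrite RRe_real // normr_real. Qed.

Section InverseJoukowski.
Context {R : realType} {s : R[i] -> R[i]}.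
Let K : numFieldType := R[i].
Hypothesis sP : is_sqrt_x2m1 s.

Let zE x : off_segment R x -> (x - s x) * (x + s x) = 1.
Proof. by case: sP => sE _ _ Dx; rewrite -subr_sqr sE // opprB addrC subrK. Qed.

Lemma joukowski_inverse x : off_segment R x ->
  [/\ x - s x != 0, (x - s x)^-1 = x + s x &
      x = ((x - s x) + (x - s x)^-1) / 2%:R].
Proof.
move=> Dx; have e := zE Dx.
have z0 : x - s x != 0.
  by apply/eqP => z0; move: e; rewrite z0 mul0r => /eqP; rewrite eq_sym oner_eq0.
have zV : (x - s x)^-1 = x + s x by apply: (mulfI z0); rewrite e divff.
by split=> //; rewrite zV; field.
Qed.

(** When |z| = 1 the inverse of z is its conjugate, hence x = Re z lies in [-1,1]. *)
Lemma off_segment_normc_inverse_neq1 x : off_segment R x -> `|x - s x| != 1.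
Proof.
move=> Dx; apply/eqP => z1; apply: (Dx).
have [z0 zV xE] := joukowski_inverse Dx.
move: (x - s x) z0 z1 xE {zV} => z z0 z1 xE.
have zV : z^-1 = z^*%C.
  by apply: (mulfI z0); rewrite divff // -sqr_normc z1 expr1n.
exists (complex.Re z) => /=.
  rewrite in_itv /= -ler_norml -lecR; apply: le_trans (normc_ge_Re z) _.
  by rewrite z1.
rewrite xE zV; case: z {z0 z1 xE zV} => a b.
by apply/eqP; rewrite eq_complex /=; apply/andP; split; apply/eqP => /=; field.
Qed.

Lemma inverse_continuous (x : K) : off_segment R x ->
  {for x, continuous (fun y : K => (y - s y : K))}.
Proof.
case: sP => _ ds _ Dx.
have sc : {for x, continuous (s : K -> K)}.
  apply: (@differentiable_continuous K K^o K^o).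
  by apply/derivable1_diffP; exact: ds.
by apply: (@continuousB K K^o K (fun y => y)).
Qed.

Lemma off_segmentZ x (t : R) :
  1 <= t -> off_segment R x -> off_segment R (t%:C * x).
Proof.
move=> t1 Dx [u /= u1 uE]; apply: Dx; exists (u / t).
  have tp : 0 < t by apply: lt_le_trans t1.
  move: u1; rewrite /= !in_itv /= -!ler_norml normrM normfV (gtr0_norm tp) => u1.
  by rewrite ler_pdivrMr // mul1r (le_trans u1).
have t0 : t%:C != 0.
  by rewrite fmorph_eq0; apply: contraTneq t1 => ->; rewrite -ltNge.
by apply: (mulfI t0); rewrite -uE -rmorphM mulrC divfK // -(fmorph_eq0 (real_complex R)).
Qed.

(** This is where the choice of the branch enters: s x / x is close to 1 far away,
so that x + s x, the inverse of x - s x, has modulus at least |x|. *)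
Lemma inverse_far_lt1 : exists M : R, forall x, off_segment R x ->
  M%:C < `|x| -> `|x - s x| < 1.
Proof.
case: sP => _ _ /(_ 1 ltr01) [M sM].
exists (Num.max M 1) => x Dx; rewrite ltcE /= => /andP[Im0].
rewrite gt_max => /andP[xM x1].
have {}xM : M%:C < `|x| by rewrite ltcE Im0.
have {}x1 : 1 < `|x| by rewrite ltcE Im0.
have [z0 zV _] := joukowski_inverse Dx.
have x0 : x != 0 by rewrite -normr_gt0 (lt_trans ltr01).
rewrite -[x - s x]invrK normfV zV invf_lt1; last first.
  by rewrite -zV normr_gt0 invr_eq0.
have -> : x + s x = x * (2%:R + (s x / x - 1)) by field.
rewrite normrM; apply: lt_le_trans x1 _; rewrite ler_peMr //.
apply: le_trans (lerB_normD _ _); rewrite normr_nat lerBrDr.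
have e2 : `|s x / x - 1| <= 1 := ltW (sM _ xM).
by rewrite [leRHS](_ : 2%:R = 1 + 1) ?lerD2l.
Qed.

Let ray_modulus (x : K) (t : R) : R := complex.Re `|t%:C * x - s (t%:C * x)|.

Let ray_modulus_continuous x (t : R) :
  off_segment R (t%:C * x) -> {for t, continuous (ray_modulus x)}.
Proof.
move=> Dt; apply/(@cvgrPdist_lt _ _ _ (nbhs t)) => e e0.
have ep : 0 < e%:C by rewrite ltcR.
have := (@cvgrPdist_lt _ _ _ (nbhs (t%:C * x : K))
  (nbhs_filter _) _ _).1 (inverse_continuous Dt) _ ep.
have ct : (u%:C * x : K) @[u --> t] --> (t%:C * x : K).
  apply/(@cvgrPdist_lt _ _ _ (nbhs t)) => d d0.
  have dE : d = (complex.Re d)%:C by rewrite RRe_real // gtr0_real.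
  have xE : `|x| = (complex.Re `|x|)%:C := normcRe x.
  have x0 : 0 <= complex.Re `|x| by rewrite -lecR -xE; exact: normr_ge0.
  have d1 : 0 < complex.Re d / (1 + complex.Re `|x|).
    by apply: divr_gt0; [rewrite -ltcR -dE; exact: d0|exact: ltr_pwDl].
  near=> u.
  rewrite -mulrBl -rmorphB normrM normcR.
  rewrite xE dE -rmorphM ltcR.
  have : `|t - u| < complex.Re d / (1 + complex.Re `|x|).
    near: u; apply: cvgr_dist_lt => //; exact: cvg_id.
  rewrite ltr_pdivlMr ?ltr_pwDl //; apply: le_lt_trans.
  by rewrite ler_wpM2l // lerDr.
move=> nb; move: (ct _ nb); apply: (@filterS _ (nbhs t)) => u /=.
rewrite /ray_modulus; move: (_ - s _) => w; move: (_ - s _) => v wv.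
apply: le_lt_trans (_ : complex.Re `|w - v| < e); last by rewrite -ltcR -normcRe.
rewrite -lecR -normcRe.
have -> : `|complex.Re `|w| - complex.Re `|v| |%:C = `| `|w| - `|v| |.
  by rewrite (normcRe w) (normcRe v) -rmorphB normcR /=.
exact: ler_dist_dist.
Unshelve. all: by end_near. Qed.

(** The modulus is less than 1 at the far end of the ray through x and avoids the
value 1 along the ray. *)
Lemma inverse_normc_lt1 x : off_segment R x -> `|x - s x| < 1.
Proof.
move=> Dx; have [M far] := inverse_far_lt1.
have hE t : `|t%:C * x - s (t%:C * x)| = (ray_modulus x t)%:C by exact: normcRe.
have h1 : `|x - s x| = (ray_modulus x 1)%:C by rewrite -hE mul1r.
rewrite h1 ltcE /= eqxx /= ltNge; apply/negP => hge.
have x0 : 0 < complex.Re `|x|.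
  rewrite -ltcR -normcRe normr_gt0; apply/eqP => x0; apply: Dx; exists 0 => //=.
  by rewrite in_itv /= lerN10 ler01.
pose T : R := 1 + `|M| / complex.Re `|x|.
have T1 : 1 <= T by rewrite lerDl divr_ge0 // ltW.
have hT : ray_modulus x T < 1.
  rewrite -ltcR -hE; apply: far; first exact: off_segmentZ.
  rewrite normrM (normcRe x) normcR -rmorphM ltcR.
  rewrite ger0_norm; last exact: le_trans T1.
  by rewrite mulrDl mul1r divfK ?gt_eqF //; have := ler_norm M; lra.
have [||t tT ht] := @IVT R (ray_modulus x) 1 T 1 T1.
- apply: continuous_in_subspaceT => t; rewrite inE /= in_itv /= => /andP[t1 _].
  by apply: ray_modulus_continuous; exact: off_segmentZ.
- by rewrite ge_min (ltW hT) orbT /= le_max hge.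
move: tT; rewrite in_itv /= => /andP[t1 _].
have := off_segment_normc_inverse_neq1 (off_segmentZ t1 Dx).
by rewrite hE ht eqxx.
Qed.

End InverseJoukowski.

(** The square a^2 - 1 of s a is positive, so s a is one of its two real roots; the
estimate on the modulus is the one for all points off the segment. *)
Lemma inverse_real {R : realType} (s : R[i] -> R[i]) (a : R) :
  is_sqrt_x2m1 s -> a \notin `[-1, 1] ->
  exists2 r : R, a%:C - s a%:C = r%:C & `|r| < 1.
Proof.
move=> sP a1.
have Da : off_segment R a%:C.
  by case=> u /= u1 [ua]; move: a1; rewrite -ua u1.
have a2 : 0 <= a ^+ 2 - 1.
  rewrite subr_ge0 -real_normK ?num_real // exprn_ege1 //.
  by move: a1; rewrite in_itv /= -ler_norml -ltNge => /ltW.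
have [sE _ _] := sP.
have : s a%:C ^+ 2 = (Num.sqrt (a ^+ 2 - 1))%:C ^+ 2.
  by rewrite sE // -!rmorphXn /= sqr_sqrtr // rmorphB.
have lt1 r : a%:C - s a%:C = r%:C -> `|r| < 1.
  move=> e; have := inverse_normc_lt1 sP Da.
  by rewrite e normcR ltcE => /andP[].
move/eqP; rewrite eqf_sqr => /orP[] /eqP e.
  by exists (a - Num.sqrt (a ^+ 2 - 1)); [|apply: lt1]; rewrite e rmorphB.
by exists (a + Num.sqrt (a ^+ 2 - 1)); [|apply: lt1]; rewrite e opprK rmorphD.
Qed.

Lemma nneseries_pinfty_partial_sums {R : realType} (u : nat -> R) :
  (forall k, 0 <= u k) -> (\sum_(0 <= k <oo) (u k)%:E = +oo)%E ->
  forall A : R, \forall n \near \oo, A <= \sum_(k < n) u k.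
Proof.
move=> u0 uy A.
have : (\sum_(0 <= k < n) (u k)%:E)%E @[n --> \oo] --> +oo%E.
  rewrite -uy; apply: is_cvg_nneseries => k _ _.
  by rewrite lee_fin.
move/cvgeyPge => /(_ A); apply: filterS => n.
by rewrite sumEFin lee_fin big_mkord.
Qed.

(** * Uniform convergence *)

Section UniformBound.
Context {R : realType} {s : R[i] -> R[i]}.
Hypothesis sP : is_sqrt_x2m1 s.
Context {r : nat -> R} {c : nat -> R[i]}.
Hypothesis cE : forall k, c k = (r k)%:C.
Hypothesis r1 : forall k, `|r k| < 1.

Lemma moebius_product_bound (z : R[i]) (rho : R) n :
  0 <= rho -> rho < 1 -> `|z| <= rho%:C ->
  `|\prod_(k < n) (z - c k)| ^+ 2 <=
  ((1 + (1 - rho ^+ 2) / 4%:R * \sum_(k < n) (1 - `|r k|))^-1)%:C *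
  `|\prod_(k < n) (1 - c k * z)| ^+ 2.
Proof.
move=> r0 rho1 zr; set d := (1 - rho ^+ 2) / 4%:R.
have d0 : 0 <= d by rewrite divr_ge0 // subr_ge0 expr_le1 // ltW.
have d1 : d <= 1 by have := sqr_ge0 rho; rewrite /d; lra.
have u01 k : 0 <= d * (1 - `|r k|) <= 1.
  have rk : 0 <= 1 - `|r k| <= 1.
    by rewrite subr_ge0 (ltW (r1 k)) /= lerBlDr lerDl normr_ge0.
  by move/andP: rk => [rk0 rk1]; rewrite mulr_ge0 //= mulr_ile1.
apply: (@le_trans _ _ ((\prod_(k < n) (1 - d * (1 - `|r k|)))%:C *
    `|\prod_(k < n) (1 - c k * z)| ^+ 2)).
  rewrite rmorph_prod !normr_prod -!prodrXl -big_split /=.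
  apply: ler_prod => k _; rewrite exprn_ge0 //= cE.
  exact: moebius_factor_bound.
rewrite ler_wpM2r ?exprn_ge0 // lecR mulr_sumr.
by have /andP[] := prod_1B_le n u01.
Qed.

(** The last factor bounds |1 / s y|: with z = y - s y, 2 |s y| >= |2 z s y| = |1 - z^2|
>= 1 - rho^2. *)
Lemma cheb_quotient_bound (y : R[i]) (rho : R) n :
  let q := (1 + (1 - rho ^+ 2) / 4%:R * \sum_(k < n) (1 - `|r k|))^-1 in
  off_segment R y -> 0 <= rho -> rho < 1 -> `|y - s y| <= rho%:C ->
  q <= 2%:R^-1 ->
  exists2 v, has_value idfun
    (tofrac (cheb_num c n).2 / tofrac (cheb_num c n).1) y v &
    `|(s y)^-1 - v| <= (4%:R * q * (2%:R / (1 - rho ^+ 2)))%:C.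
Proof.
move=> q Dy r0 rho1 zr q2.
have [z0 zV yE] := joukowski_inverse sP Dy.
have wE : (y - s y) - (y - s y)^-1 = - (2%:R * s y) by rewrite zV; ring.
have := moebius_product_bound n r0 rho1 zr; rewrite -/q.
have := inverse_normc_lt1 sP Dy.
move: (y - s y) z0 zr wE yE {zV} => z z0 zr wE yE z1 XY.
have rr : rho ^+ 2 < 1 by rewrite expr_lt1.
have q0 : 0 <= q.
  rewrite invr_ge0 addr_ge0 // mulr_ge0 //.
    by rewrite divr_ge0 // subr_ge0 ltW.
  by apply: sumr_ge0 => k _; rewrite subr_ge0 ltW.
have sB : `|(s y)^-1| <= (2%:R / (1 - rho ^+ 2))%:C.
  have zz : `|z| ^+ 2 <= (rho ^+ 2)%:C.
    by rewrite rmorphXn; apply: lerXn2r; rewrite // nnegrE // lecR.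
  have sz : (1 - rho ^+ 2)%:C <= 2%:R * `|s y|.
    apply: (@le_trans _ _ `|1 - z ^+ 2|).
      apply: le_trans (lerB_dist _ _); rewrite normr1 normrX rmorphB rmorph1.
      by rewrite lerD2l lerN2.
    have -> : 1 - z ^+ 2 = z * (2%:R * s y).
      by rewrite -[2%:R * _]opprK -wE; field.
    by rewrite !normrM normr_nat ler_piMl ?mulr_ge0 // ltW.
  have d0 : 0 < (1 - rho ^+ 2)%:C by rewrite ltcR subr_gt0.
  have s0 : 0 < `|s y|.
    by have := lt_le_trans d0 sz; rewrite pmulr_rgt0 // ltr0n.
  rewrite normfV rmorphM fmorphV rmorph_nat ler_pdivlMr // mulrC.
  by rewrite ler_pdivrMr.
have Y0 : \prod_(k < n) (1 - c k * z) != 0.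
  apply/prodf_neq0 => k _; rewrite subr_eq0; apply/eqP => e.
  have : `|c k * z| < 1.
    rewrite normrM; apply: mulr_ilt1 => //.
    by rewrite cE normcR ltcR; exact: r1.
  by rewrite -e normr1 ltxx.
have z21 : z ^+ 2 != 1.
  apply/eqP => z2; have e : `|z| ^+ 2 = 1 by rewrite -normrX z2 normr1.
  by move: z1; rewrite -(@expr_lt1 _ 2) // e ltxx.
have q2' : q%:C <= 2%:R^-1 :> R[i].
  by rewrite -(rmorph_nat (real_complex R)) -fmorphV lecR.
have q0' : 0 <= q%:C by rewrite lecR.
have [S0 err] := sum_sqr_quotient_bound (s y)^-1 Y0 q0' q2' XY.
have := cheb_quotient_value z0 z21 S0; rewrite -yE wE => v.
eexists; first exact: v.
have -> : 2%:R / - (2%:R * s y) = - (s y)^-1.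
  by rewrite invrN invfM mulrN mulrA divff ?mul1r // pnatr_eq0.
apply: le_trans err _.
rewrite rmorphM rmorphM rmorph_nat.
by apply: ler_wpM2l => //; rewrite mulr_ge0 // lecR.
Qed.

End UniformBound.

Theorem theorem6p1 (R : realType) (sqrt_x2m1 : R[i] -> R[i]) (a : nat -> R) :
  is_sqrt_x2m1 sqrt_x2m1 ->
  (forall k, a k \notin `[-1, 1]) ->
  injective a ->
  let c (k : nat) : R[i] := (a k)%:C - sqrt_x2m1 (a k)%:C in
  (\sum_(0 <= k <oo) (1 - complex.Re `|c k|)%:E = +oo)%E ->
  ratfun_cvg_locally_uniformly
    (fun n => chebU c n / chebT c n.+1)
    (fun x => (sqrt_x2m1 x)^-1)
    (off_segment R).
Proof.
set s := sqrt_x2m1 => sP a1 _ c csum.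
have /choice[r cr] : forall k, exists r : R, c k = r%:C /\ `|r| < 1.
  by move=> k; have [r ? ?] := inverse_real sP (a1 k); exists r.
have cE k : c k = (r k)%:C by case: (cr k).
have r1 k : `|r k| < 1 by case: (cr k).
have diverge : forall A : R, \forall n \near \oo, A <= \sum_(k < n) (1 - `|r k|).
  apply: (@nneseries_pinfty_partial_sums R (fun k => 1 - `|r k|)) => [k|].
    by rewrite subr_ge0 ltW.
  rewrite -[RHS]csum; apply: eq_eseriesr => k _.
  by rewrite cE normcR.
move=> x Dx.
have z1 : complex.Re `|x - s x| < 1.
  by have := inverse_normc_lt1 sP Dx; rewrite ltcE => /andP[].
have z0 : 0 <= complex.Re `|x - s x| by rewrite -lecR -normcRe; exact: normr_ge0.
(* Any rho strictly between |x - s x| and 1 would do. *)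
pose rho := (1 + complex.Re `|x - s x|) / 2%:R.
have r0 : 0 <= rho by rewrite /rho; lra.
have rho1 : rho < 1 by rewrite /rho; lra.
have zrho : complex.Re `|x - s x| < rho by rewrite /rho; lra.
exists [set y | `|y - s y| <= rho%:C].
  have ep : 0 < (rho - complex.Re `|x - s x|)%:C by rewrite ltcR subr_gt0.
  have := (@cvgrPdist_lt _ _ _ (nbhs (x : (R[i] : numFieldType)))
    (nbhs_filter _) _ _).1 (inverse_continuous sP Dx) _ ep.
  apply: filterS => y /= /ltW; rewrite distrC => h.
  rewrite -[y - s y](subrK (x - s x)); apply: le_trans (ler_normD _ _) _.
  by rewrite -lerBrDr (normcRe (x - s x)) -rmorphB.
pose q n := (1 + (1 - rho ^+ 2) / 4%:R * \sum_(k < n.+1) (1 - `|r k|))^-1.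
have d0 : 0 < (1 - rho ^+ 2) / 4%:R by rewrite divr_gt0 // subr_gt0 expr_lt1.
have q_small (e : R) : 0 < e -> \forall n \near \oo, q n <= e.
  move=> e0.
  have [N _ hN] := diverge (e^-1 / ((1 - rho ^+ 2) / 4%:R)).
  exists N => // n /= Nn.
  have := hN n.+1 (leq_trans Nn (leqnSn n)).
  rewrite ler_pdivrMr // mulrC => h.
  rewrite /q invf_ple ?posrE //; last first.
    by rewrite ltr_pwDl // (le_trans _ h) // invr_ge0 ltW.
  by apply: le_trans h _; rewrite lerDr.
have bnd n y : off_segment R y -> `|y - s y| <= rho%:C -> q n <= 2%:R^-1 ->
    exists2 v, has_value idfun (chebU c n / chebT c n.+1) y v &
    `|(s y)^-1 - v| <= (4%:R * q n * (2%:R / (1 - rho ^+ 2)))%:C.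
  move=> Dy zy qn; rewrite cheb_quotient.
  exact: (cheb_quotient_bound sP cE r1).
have half : \forall n \near \oo, q n <= 2%:R^-1 by apply: q_small; rewrite invr_gt0.
split.
  apply: filterS half => n qn y [zy Dy].
  by have [v hv _] := bnd n y Dy zy qn; exists v.
move=> P /uniform_nbhs[E [entE EP]].
have [e /= e0 eE] :
    exists2 e : R[i], 0 < e & forall u v : R[i], `|u - v| < e -> E (u, v).
  move: entE; rewrite -entourage_from_ballE => -[e e0 eE]; exists e => // u v uv.
  by apply: eE.
have eR : e = (complex.Re e)%:C by rewrite RRe_real // gtr0_real.
have e'0 : 0 < complex.Re e by rewrite -ltcR -eR.
(* C is the constant of the error bound; asking for q n <= e / (2 C) makes the error
   at most e / 2, hence strictly less than e. *)
pose C : R := 8%:R / (1 - rho ^+ 2).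
have C0 : 0 < C by rewrite divr_gt0 // subr_gt0 expr_lt1.
have small : \forall n \near \oo, q n <= complex.Re e / (2%:R * C).
  by apply: q_small; rewrite divr_gt0 // mulr_gt0.
near=> n; apply: EP => y [zy Dy]; apply: eE.
have qn : q n <= 2%:R^-1 by near: n.
have [v hv err] := bnd n y Dy zy qn.
rewrite (ratfun_evalP hv); apply: le_lt_trans err _.
rewrite eR ltcR.
have : q n <= complex.Re e / (2%:R * C) by near: n.
have C20 : 0 < 2%:R * C by exact: mulr_gt0.
rewrite ler_pdivlMr // => h.
have -> : 4%:R * q n * (2%:R / (1 - rho ^+ 2)) = q n * (2%:R * C) / 2%:R.
  by rewrite /C; field; rewrite subr_eq0 eq_sym lt_eqF // expr_lt1.
lra.
Unshelve. all: by end_near. Qed.
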